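(* Let $\mathcal{L}\subseteq\mathbb{R}^m$ be a $d$-dimensional linear subspace containing a vector with all coordinates strictly positive, and regard $\mathbb{R}^m\subset\mathbb{S}^m$ as the space of diagonal $m\times m$-matrices. Then the ML degree of the diagonal linear concentration model defined by $\mathcal{L}$ is equal to $\beta(\mathcal{L})$.
   Context: $\mathbb{S}^m$ is the space of real symmetric $m\times m$-matrices; $\mathbb{R}^m$ carries the standard inner product and $\mathcal{L}^\perp\subseteq\mathbb{R}^m$ is the orthogonal complement of $\mathcal{L}$. Definition of $\beta(\mathcal{L})$: for a generic vector $u\in\mathbb{R}^m_{>0}$, $\beta(\mathcal{L})$ is the number of bounded regions of the hyperplane arrangement in the $(m-d)$-dimensional affine space $u+\mathcal{L}^\perp$ obtained by intersecting it with the $m$ coordinate hyperplanes $\{x_i=0\}$, $i=1,\dots,m$. This number is independent of the generic choice of $u$ and depends only on the matroid of rank $m-d$ on $\{1,\dots,m\}$ associated with $\mathcal{L}$ (the matroid of the coordinate functions $x_1,\dots,x_m$ restricted to $\mathcal{L}^\perp$). Definition of ML degree: fix a $d\times m$ matrix $A$ whose row space is $\mathcal{L}$. For a vector of sufficient statistics $t=Ax_0$ with $x_0\in\mathbb{R}^m_{>0}$, the maximum likelihood estimate is the unique maximizer $\hat x$ of $\sum_{i=1}^m\log(x_i)$ over $\{x\in\mathbb{R}^m_{>0}: Ax=t\}$. The ML degree is the degree of the algebraic function $t\mapsto\hat x$, i.e. for generic $t$ the number of solutions $x\in(\mathbb{C}\setminus\{0\})^m$ of $Ax=t$ and $(x_1^{-1},\dots,x_m^{-1})\in\mathcal{L}\otimes\mathbb{C}$.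 *)

(* Defs.v *)
From HB Require Import structures.
From mathcomp Require Import all_boot all_order all_algebra.
From mathcomp Require Import complex.
From mathcomp Require Import all_classical all_reals all_analysis.
From mathcomp Require Import -(notations) mpoly.

Set Implicit Arguments.
Unset Strict Implicit.
Unset Printing Implicit Defensive.

Import Order.TTheory GRing.Theory Num.Theory.
Import numFieldNormedType.Exports.

Local Open Scope classical_set_scope.
Local Open Scope card_scope.
Local Open Scope ring_scope.

(* [P] holds off the zero locus of some nonzero polynomial. *)
Definition generic (F : comNzRingType) (n : nat) (P : 'rV[F]_n -> Prop) : Prop :=
  exists2 p : mpoly n F, p != 0 & forall v : 'rV[F]_n, meval (v ord0) p != 0 -> P v.

Definition positive_vector (R : realType) (m : nat) (v : 'rV[R]_m) : Prop :=
  forall i, 0 < v ord0 i.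

Definition orthogonal_complement (R : realType) (m : nat)
    (L : {vspace 'rV[R]_m}) : set 'rV[R]_m :=
  [set y : 'rV[R]_m | forall v : 'rV[R]_m, v \in L -> \sum_i v ord0 i * y ord0 i = 0].

(* The part of the affine space u + L^perp lying on no coordinate
   hyperplane.  A hyperplane {x_i = 0} which misses u + L^perp
   contributes nothing to the arrangement. *)
Definition arrangement_complement (R : realType) (m : nat)
    (L : {vspace 'rV[R]_m}) (u : 'rV[R]_m) : set 'rV[R]_m :=
  [set x : 'rV[R]_m | orthogonal_complement L (x - u) /\ forall i, x ord0 i != 0].

Definition regions (R : realType) (m : nat)
    (L : {vspace 'rV[R]_m}) (u : 'rV[R]_m) : set (set 'rV[R]_m) :=
  connected_component (arrangement_complement L u)
    @` arrangement_complement L u.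

Definition bounded_regions (R : realType) (m : nat)
    (L : {vspace 'rV[R]_m}) (u : 'rV[R]_m) : set (set 'rV[R]_m) :=
  [set C | regions L u C /\ bounded_set C].

Definition is_beta (R : realType) (m : nat)
    (L : {vspace 'rV[R]_m}) (n : nat) : Prop :=
  generic (fun u : 'rV[R]_m =>
    positive_vector u -> bounded_regions L u #= `I_n).

(* L (x) C = L + i L inside C^m. *)
Definition complexification (R : realType) (m : nat)
    (L : {vspace 'rV[R]_m}) : set 'rV[R[i]]_m :=
  [set y : 'rV[R[i]]_m | map_mx (@complex.Re R) y \in L /\ map_mx (@complex.Im R) y \in L].

Definition is_row_space (R : realType) (d m : nat)
    (A : 'M[R]_(d, m)) (L : {vspace 'rV[R]_m}) : Prop :=
  forall v : 'rV[R]_m, (v \in L) = (v <= A)%MS.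

(* x is a row, so A x = t reads x *m A^T = t. *)
Definition likelihood_solutions (R : realType) (d m : nat)
    (A : 'M[R]_(d, m)) (L : {vspace 'rV[R]_m}) (t : 'rV[R[i]]_d) :
    set 'rV[R[i]]_m :=
  [set x : 'rV[R[i]]_m | [/\ forall i, x ord0 i != 0,
               x *m (map_mx (real_complex R) A)^T = t
             & complexification L (map_mx GRing.inv x)]].

(* The matrix A enters as a presentation of its row space L; the count is
   over generic complex t, as for the degree of an algebraic function. *)
Definition is_ML_degree (R : realType) (d m : nat)
    (A : 'M[R]_(d, m)) (L : {vspace 'rV[R]_m}) (n : nat) : Prop :=
  generic (fun t : 'rV[R[i]]_d => likelihood_solutions A L t #= `I_n).

Lemma muni_neq0 (F : comNzRingType) (n : nat) (p : mpoly n.+1 F) :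
  p != 0 -> muni p != 0.
Proof.
rewrite -msupp_eq0; case Es : (msupp p) => [|m1 s] // _.
have m1p : m1 \in msupp p by rewrite Es mem_head.
pose wd (i : 'I_n) : 'I_n.+1 := widen_ord (leqnSn n) i.
apply/eqP => p0.
have := congr1 (fun q : {poly mpoly n F} =>
  mcoeff (Multinom [tuple m1 (wd i) | i < n]) q`_(m1 ord_max)) p0.
rewrite muniE coef_sum raddf_sum /= coef0 mcoeff0 (bigD1_seq m1) ?msupp_uniq//=.
rewrite coefZ coefXn eqxx mulr1 mcoeffZ mcoeffX eqxx mulr1.
rewrite big1 ?addr0 => [/eqP|m nm]; first by rewrite mcoeff_eq0 m1p.
rewrite coefZ coefXn; case: eqP => [e|_]; last by rewrite mulr0 mcoeff0.
rewrite mulr1 mcoeffZ mcoeffX; case: eqP => [e2|_]; last by rewrite mulr0.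
case/eqP: nm; apply/mnmP => i.
have [[j ->]|->] : (exists j, i = wd j) \/ i = ord_max.
- case: (ltnP i n) => [lt|ge]; [left|right].
    by exists (Ordinal lt); apply/val_inj.
  by apply/val_inj/eqP; rewrite eqn_leq ge -ltnS ltn_ord.
- by have := congr1 (fun q : multinom n => q j) e2; rewrite !mnmE.
- exact/esym.
Qed.

Lemma muni_horner (F : comNzRingType) (n : nat) (v : 'I_n.+1 -> F)
    (p : mpoly n.+1 F) :
  meval v p =
    (map_poly (meval (fun i => v (widen_ord (leqnSn n) i))) (muni p)).[v ord_max].
Proof.
rewrite muniE raddf_sum /= horner_sum mevalE; apply: eq_bigr => m _.
rewrite map_polyZ map_polyXn hornerZ hornerXn /= mevalZ mevalX big_ord_recr /=.
by rewrite mulrA; congr (_ * _ * _); apply: eq_bigr => i _; rewrite mnmE.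
Qed.

Lemma positive_non_root (F : numFieldType) (q : {poly F}) :
  q != 0 -> exists2 x, 0 < x & q.[x] != 0.
Proof.
move=> q0; pose s := [seq (k.+1)%:R : F | k <- iota 0 (size q)].
have us : uniq s.
  rewrite map_inj_uniq ?iota_uniq // => a b /eqP.
  by rewrite eqr_nat eqSS => /eqP.
have /allPn[_ /mapP[k _ ->] nr] : ~~ all (root q) s.
  apply/negP => rs; have := max_poly_roots q0 rs us.
  by rewrite size_map size_iota ltnn.
by exists (k.+1)%:R => //; rewrite ltr0n.
Qed.

Lemma generic_positive_point (F : numFieldType) (n : nat) (p : mpoly n F) :
  p != 0 -> exists2 v : 'I_n -> F, (forall i, 0 < v i) & meval v p != 0.
Proof.
elim: n p => [|n IH] p p0.
  exists (fun _ => 1) => //; apply: contraNneq p0 => e; apply/eqP/mpolyP => m.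
  have mm (m' : multinom 0) : m' = mnm0 by apply/mnmP => -[].
  have pE : p = mpolyC 0 (mcoeff mnm0 p).
    by apply/mpolyP => k; rewrite (mm k) mcoeffC eqxx mulr1.
  by move: e; rewrite {1}pE mevalC => e; rewrite (mm m) mcoeff0.
have /IH[w w0 wq] : lead_coef (muni p) != 0 by rewrite lead_coef_eq0 muni_neq0.
have /positive_non_root[x x0 qx] : map_poly (meval w) (muni p) != 0.
  apply: contraNneq wq => e.
  by have := congr1 (fun q : {poly F} => q`_(size (muni p)).-1) e;
     rewrite coef_map coef0 /= => ->.
pose v (i : 'I_n.+1) := if unlift ord_max i is Some j then w j else x.
have vmax : v ord_max = x by rewrite /v unlift_none.
have vw (i : 'I_n) : v (widen_ord (leqnSn n) i) = w i.
  have -> : widen_ord (leqnSn n) i = lift ord_max i.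
    by apply/val_inj; rewrite /= /bump leqNgt ltn_ord.
  by rewrite /v liftK.
exists v => [i|]; first by rewrite /v; case: unlift.
rewrite muni_horner vmax.
by rewrite (_ : (fun i => v (widen_ord (leqnSn n) i)) = w) //; apply/funext.
Qed.

Lemma generic_meet (F : numFieldType) (n : nat) (P Q : 'rV[F]_n -> Prop) :
  generic P -> generic Q ->
  exists v : 'rV[F]_n, [/\ forall i, 0 < v ord0 i, P v & Q v].
Proof.
move=> [p p0 pP] [q q0 qQ].
have /generic_positive_point[w w0] : p * q != 0 by rewrite mulf_neq0.
rewrite mevalM mulf_eq0 negb_or => /andP[pw qw].
have E (r : mpoly n F) : meval ((\row_i w i : 'rV[F]_n) ord0) r = meval w r.
  by apply: meval_eq => i; rewrite mxE.
by exists (\row_i w i); split; [move=> i; rewrite mxE|apply: pP|apply: qQ]; rewrite ?E.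
Qed.

Lemma is_beta_unique (R : realType) (m : nat) (L : {vspace 'rV[R]_m})
    (n n' : nat) :
  is_beta L n -> is_beta L n' -> n = n'.
Proof.
move=> h h'; have [u [u0 /(_ u0) e /(_ u0) e']] := generic_meet h h'.
by apply/card_eq_II; apply: card_eq_trans e'; rewrite card_eq_sym.
Qed.

Lemma is_ML_degree_unique (R : realType) (d m : nat) (A : 'M[R]_(d, m))
    (L : {vspace 'rV[R]_m}) (n n' : nat) :
  is_ML_degree A L n -> is_ML_degree A L n' -> n = n'.
Proof.
move=> h h'; have [t [_ e e']] := generic_meet h h'.
by apply/card_eq_II; apply: card_eq_trans e'; rewrite card_eq_sym.
Qed.

(* Main.v *)
(** For real data [t = u A^T] every complex solution [x] of the likelihood
    equations is real: [Im x] lies in the orthogonal complement of [L] and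
    [Im (1/x)] in [L], so [0 = - sum_i (Im x_i)^2 / |x_i|^2].  The real solutions
    are the critical points of [prod_i |x_i|] on [u + L^perp] off the coordinate
    hyperplanes, and each bounded region contains exactly one of them while an
    unbounded region contains none.  Hence for every real [u], generic or not,
    the bounded regions are equinumerous with the solutions at [u A^T].

    It remains to see that the number of solutions is constant for generic
    complex [t].  By quantifier elimination over the algebraically closed field
    [R[i]], "there are at least k solutions" is a boolean combination of
    polynomial equations in [t], so it holds generically or fails generically.
    It fails for [k > 2^m] at real data, since the solutions there are told apart
    by their signs; hence the largest [k] for which it holds generically is the
    generic number of solutions. *)

Require Import Defs.
From HB Require Import structures.
From mathcomp Require Import all_boot all_order all_algebra.
From mathcomp Require Import complex closed_field.
From mathcomp Require Import all_classical all_reals all_analysis.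
From mathcomp Require Import -(notations) mpoly.
From mathcomp Require Import ring lra.

Set Implicit Arguments.
Unset Strict Implicit.
Unset Printing Implicit Defensive.

Import Order.TTheory GRing.Theory Num.Theory.
Import numFieldNormedType.Exports.

Local Open Scope classical_set_scope.
Local Open Scope ring_scope.

(** * Regions and critical points of the real arrangement *)

Lemma scaled_coord_continuous (R : realType) (m : nat) (c : R) (i : 'I_m) :
  continuous (fun y : 'rV[R]_m => c * y ord0 i).
Proof.
move=> y; apply: (@continuousM R _ (fun=> c) (fun y : 'rV[R]_m => y ord0 i)).
  exact: cst_continuous.
exact: coord_continuous.
Qed.

Lemma bounded_set_coordP (R : realType) (m : nat) (C : set 'rV[R]_m) :
  bounded_set C <-> exists M, forall x, C x -> forall i, `|x ord0 i| <= M.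
Proof.
split=> [[M [_ CM]]|[M CM]].
  exists (M + 1) => x Cx i; apply: le_trans (CM (M + 1) _ x Cx).
    rewrite [leRHS]/Num.norm /= mx_normrE.
    by apply/bigmax_geP; right; exists (ord0, i).
  by rewrite ltrDl.
exists `|M|; split=> [|N MN x Cx]; first by rewrite num_real.
rewrite /= [leLHS]/Num.norm /= mx_normrE; apply/bigmax_leP; split=> [|[j i] _] /=.
  exact/ltW/(le_lt_trans _ MN).
by rewrite (ord1 j) (le_trans (CM x Cx i)) // ltW // (le_lt_trans (ler_norm _) MN).
Qed.

(** * Critical points of products of affine functions *)

Section LogDerivative.
Variable R : realType.

Lemma deriv_prod_affine (I : eqType) (s : seq I) (a b : I -> R) :
  (forall i, a i != 0) ->
  (\prod_(i <- s) ((a i)%:P + b i *: 'X))^`().[0] =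
  (\prod_(i <- s) a i) * \sum_(i <- s) b i / a i.
Proof.
move=> a0; elim: s => [|i s IH]; first by rewrite !big_nil derivC horner0 mulr0.
have E : (\prod_(i <- s) ((a i)%:P + b i *: 'X)).[0] = \prod_(i <- s) a i.
  rewrite horner_prod; apply: eq_bigr => j _.
  by rewrite hornerD hornerC hornerZ hornerX mulr0 addr0.
rewrite !big_cons derivM derivD derivC derivZ derivX add0r alg_polyC.
rewrite hornerD !hornerM !hornerD IH E !hornerC hornerZ hornerX.
by field; exact: a0.
Qed.

(** As the [a i] are positive, all factors stay nonnegative for [s] near [0]. So [0] is an interior
    maximum, and the logarithmic derivative vanishes there. *)
Lemma prod_affine_max (m : nat) (a b : 'I_m -> R) :
  (forall i, 0 < a i) ->
  (forall s : R, (forall i, 0 <= a i + s * b i) ->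
     \prod_i (a i + s * b i) <= \prod_i a i) ->
  \sum_i b i / a i = 0.
Proof.
move=> a0 amax; pose p := \prod_i ((a i)%:P + b i *: 'X).
have pE s : p.[s] = \prod_i (a i + s * b i).
  rewrite horner_prod; apply: eq_bigr => j _.
  by rewrite hornerD hornerC hornerZ hornerX mulrC.
have : forall i, \forall s \near (0 : R), 0 <= a i + s * b i.
  move=> i; have cont : (fun s => a i + s * b i) @ (0 : R) --> a i + 0 * b i.
    by apply: cvgD; [exact: cvg_cst|apply: cvgM; [exact: cvg_id|exact: cvg_cst]].
  near=> s; apply: ltW; near: s.
  by apply: (cvgr_gt _ cont); rewrite mul0r addr0.
move=> /filter_forall /nbhs_ballP[e /= e0 eP].
have : is_derive (0 : R) 1 (horner p) 0.
  apply: (@derive1_at_max _ _ (- e) e).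
  - by rewrite ge0_cp // ltW.
  - by move=> s _; exact: derivable_horner.
  - by rewrite in_itv /= oppr_lt0 e0.
  - move=> s; rewrite in_itv /= -ltr_norml => se; rewrite !pE.
    under [leRHS]eq_bigr do rewrite mul0r addr0.
    by apply: amax; apply: eP; rewrite /ball /= sub0r normrN.
move=> /@derive_val; rewrite -derive1E -derivE deriv_prod_affine => [/eqP|i].
  rewrite mulf_eq0 prodf_seq_eq0 => /orP[/hasP[i _ /=]|/eqP//].
  by rewrite gt_eqF.
by rewrite gt_eqF.
Unshelve. all: by end_near. Qed.

End LogDerivative.

Section RealArrangement.
Variables (R : realType) (d m : nat) (L : {vspace 'rV[R]_m}) (A : 'M[R]_(d, m)).
Hypothesis rowA : is_row_space A L.
Implicit Types x y u v w : 'rV[R]_m.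

Lemma orthogonal_complementP y : orthogonal_complement L y <-> y *m A^T = 0.
Proof.
have dotE v : \sum_i v ord0 i * y ord0 i = (v *m y^T) ord0 ord0.
  by rewrite mxE; apply: eq_bigr => i _; rewrite mxE.
split=> [yL|yA v].
  apply/rowP => j; rewrite !mxE.
  have /yL/(eq_trans _) : row j A \in L by rewrite rowA row_sub.
  by apply; apply: eq_bigr => i _; rewrite !mxE mulrC.
rewrite rowA dotE => /submxP[c ->].
by rewrite -mulmxA -[A]trmxK -trmx_mul yA trmx0 mulmx0 mxE.
Qed.

(** The columns of [cokermx A] lie in [L^perp], and as test vectors they already force membership in
    the row space. *)
Lemma orthogonal_complementK w :
  (forall v, orthogonal_complement L v -> \sum_i v ord0 i * w ord0 i = 0) ->
  w \in L.
Proof.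
move=> wL; rewrite rowA submxE; apply/eqP/rowP => j; rewrite !mxE.
have /wL/(eq_trans _) : orthogonal_complement L (col j (cokermx A))^T.
  apply/orthogonal_complementP.
  by rewrite -trmx_mul colE mulmxA mulmx_coker mul0mx trmx0.
by apply; apply: eq_bigr => i _; rewrite !mxE mulrC.
Qed.

Lemma orthogonal_complementD x y : orthogonal_complement L x ->
  orthogonal_complement L y -> orthogonal_complement L (x + y).
Proof.
by rewrite !orthogonal_complementP mulmxDl => -> ->; rewrite addr0.
Qed.

Lemma orthogonal_complementZ (c : R) x : orthogonal_complement L x ->
  orthogonal_complement L (c *: x).
Proof. by rewrite !orthogonal_complementP -scalemxAl => ->; rewrite scaler0. Qed.

Lemma orthogonal_complementB x y : orthogonal_complement L x ->
  orthogonal_complement L y -> orthogonal_complement L (x - y).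
Proof.
by rewrite !orthogonal_complementP mulmxBl => -> ->; rewrite subr0.
Qed.

Variable u : 'rV[R]_m.
Local Notation complement := (arrangement_complement L u).

(** Critical points of [sum_i log |x_i|] on [u + L^perp]: the gradient [1/x] must be orthogonal to
    [L^perp], that is, lie in [L]. *)
Definition critical_points : set 'rV[R]_m :=
  [set x | complement x /\ map_mx GRing.inv x \in L].

(** A coordinate that never vanishes keeps its sign on a connected set; conversely, the segment
    between two points of equal signs avoids every coordinate hyperplane. *)
Lemma connected_component_signP x y : complement x ->
  connected_component complement x y <->
  complement y /\ forall i, 0 < x ord0 i * y ord0 i.
Proof.
move=> cx; split=> [[C [Cx subC conC] Cy]|[cy xy]].
  split=> [|i]; first exact: subC.
  have /connected_intervalP itvC : connected ((fun z : 'rV[R]_m => z ord0 i) @` C).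
    apply: connected_continuous_connected => //.
    by apply: continuous_subspaceT; exact: coord_continuous.
  have n0 z : C z -> z ord0 i != 0 by move=> /subC[_]; exact.
  have nC : ~ ((fun z : 'rV[R]_m => z ord0 i) @` C) 0.
    by move=> [z /n0 /eqP].
  have Ix : ((fun z : 'rV[R]_m => z ord0 i) @` C) (x ord0 i) by exists x.
  have Iy : ((fun z : 'rV[R]_m => z ord0 i) @` C) (y ord0 i) by exists y.
  have := n0 _ Cx; have := n0 _ Cy.
  rewrite !neq_lt => /orP[y0|y0] /orP[x0|x0].
  - by rewrite nmulr_rgt0.
  - by case: nC; apply: itvC Iy Ix _ _; rewrite !ltW.
  - by case: nC; apply: itvC Ix Iy _ _; rewrite !ltW.
  - by rewrite mulr_gt0.
pose g (s : R) := x + s *: (y - x).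
have : (g @` `[0, 1]) y.
  by exists 1; rewrite /= ?in_itv /= ?lexx ?ler01 // /g scale1r addrC subrK.
apply: (@connected_component_max _ complement).
- by exists 0; rewrite /= ?in_itv /= ?lexx ?ler01 // /g scale0r addr0.
- move=> _ [s /= + <-]; rewrite in_itv /= => /andP[s0 s1].
  case: cx cy => [ux x0] [uy y0]; split=> [|i].
    rewrite (_ : g s - u = (x - u) + s *: ((y - u) - (x - u))).
      apply: orthogonal_complementD => //; apply: orthogonal_complementZ.
      exact: orthogonal_complementB.
    by rewrite /g opprB addrA subrK addrAC.
  have xi2 : 0 < x ord0 i * x ord0 i by rewrite -expr2 exprn_even_gt0 //= x0.
  suff : 0 < x ord0 i * g s ord0 i.
    by apply: contraTneq => ->; rewrite mulr0 ltxx.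
  rewrite !mxE; have := xy i; move: xi2; set a := _ * _; set b := _ * _ => a0 b0.
  rewrite (_ : _ * _ = (1 - s) * a + s * b); last by rewrite /a /b; ring.
  have [->|sn0] := eqVneq s 0; first by rewrite subr0 mul1r mul0r addr0.
  apply: ltr_wpDl; first by rewrite mulr_ge0 ?subr_ge0 // ltW.
  by rewrite mulr_gt0 // lt_neqAle eq_sym sn0.
- apply: connected_continuous_connected; first exact: segment_connected.
  apply: continuous_subspaceT => s.
  apply: cvgD; first exact: cvg_cst.
  by apply: cvgZr_tmp; exact: cvg_id.
Qed.

(* Two critical points x, y in one region satisfy
   0 = <x - y, 1/x - 1/y> = - sum_i (x_i - y_i)^2 / (x_i y_i). *)
Lemma critical_point_region_inj x y : critical_points x -> critical_points y ->
  connected_component complement x = connected_component complement y -> x = y.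
Proof.
move=> [cx Lx] [cy Ly] exy.
have /(connected_component_signP _ cx)[_ xy] : connected_component complement x y.
  by rewrite exy; exact: connected_component_refl.
case: cx cy => [ux x0] [uy y0].
have o : orthogonal_complement L (x - y).
  have := orthogonal_complementB ux uy.
  by rewrite opprB addrA subrK.
have := o _ (rpredB Ly Lx) => /eqP; rewrite psumr_eq0 => [|i _].
  move=> /allP h; apply/rowP => i.
  have := h i (mem_index_enum i); rewrite /= !mxE mulf_eq0 !subr_eq0.
  by case/orP => /eqP // /invr_inj.
rewrite !mxE (_ : _ * _ = (x ord0 i - y ord0 i) ^+ 2 / (x ord0 i * y ord0 i)).
  by rewrite divr_ge0 ?sqr_ge0 // ltW.
by field; rewrite x0 y0.
Qed.

(* <y - x, 1/x> = 0 for y in the region of x, so the positive numbers y_i / x_i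
   add up to m. *)
Lemma critical_point_region_bounded x : critical_points x ->
  bounded_set (connected_component complement x).
Proof.
move=> [cx Lx]; apply/bounded_set_coordP.
(* Each [|y_i|] is at most [m |x_i|]; the sum over [i] bounds all coordinates at once. *)
exists (\sum_i m%:R * `|x ord0 i|) => y /(connected_component_signP _ cx)[cy xy] i.
case: cx cy => [ux x0] [uy y0].
have o : orthogonal_complement L (y - x).
  have := orthogonal_complementB uy ux.
  by rewrite opprB addrA subrK.
have yx j : 0 < y ord0 j / x ord0 j.
  rewrite (_ : _ / _ = (x ord0 j * y ord0 j) / x ord0 j ^+ 2).
    by rewrite divr_gt0 // exprn_even_gt0 //= x0.
  by field; exact: x0.
have sum_yx : \sum_j y ord0 j / x ord0 j = m%:R.
  apply/eqP; rewrite -subr_eq0 -[X in _ - X%:R]card_ord -sum1_card natr_sum -sumrB.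
  rewrite -{2}(o _ Lx); apply/eqP/eq_bigr => j _.
  by rewrite !mxE mulrBr mulVf // mulrC.
have yi : y ord0 i / x ord0 i <= m%:R.
  rewrite -sum_yx (bigD1 i) //= lerDl sumr_ge0 // => j _.
  exact: ltW.
rewrite (bigD1 i) //=; apply: ler_wpDr.
  by apply: sumr_ge0 => j _; rewrite mulr_ge0.
rewrite -{1}(divfK (x0 i) (y ord0 i)) normrM ler_wpM2r //.
by rewrite gtr0_norm.
Qed.

(* The maximum of prod_i |y_i| over the compact closure of a bounded region is
   positive, hence attained inside, where the logarithmic derivative vanishes. *)
Lemma bounded_region_critical_point x0 : complement x0 ->
  bounded_set (connected_component complement x0) ->
  exists2 x, critical_points x & connected_component complement x0 x.
Proof.
move=> cx0 /bounded_set_coordP[M bM]; have [ux0 x0n0] := cx0.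
have sqx0 i : 0 < x0 ord0 i * x0 ord0 i.
  by rewrite -expr2 exprn_even_gt0 //= x0n0.
(* [K] serves as the closure of the region: its sign conditions are made non-strict. *)
pose K := [set y | orthogonal_complement L (y - u) /\
                   forall i, 0 <= x0 ord0 i * y ord0 i].
have bK : bounded_set K.
  apply/bounded_set_coordP; exists (M + M + M) => y [uy y0] i.
  have x0M : `|x0 ord0 i| <= M by apply: bM; exact: connected_component_refl.
  (* The midpoint of [y] and [x0] has strict signs, so it lies in the bounded region; hence
     [|y_i| <= 2 M + M]. *)
  have : `|(2^-1 *: (y + x0)) ord0 i| <= M.
    apply: bM; apply/connected_component_signP => //.
    have pos j : 0 < x0 ord0 j * (2^-1 *: (y + x0)) ord0 j.
      have := y0 j; have := sqx0 j; rewrite !mxE.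
      move: (x0 ord0 j) (y ord0 j) => a b a2 ab.
      have -> : a * (2^-1 * (b + a)) = 2^-1 * (a * b + a * a) by field.
      by rewrite mulr_gt0 ?invr_gt0 ?ltr0n // ltr_wpDl.
    split=> // ; split=> [|j].
      rewrite (_ : _ - u = 2^-1 *: ((y - u) + (x0 - u))).
        by apply: orthogonal_complementZ; exact: orthogonal_complementD.
      by apply/rowP => j; rewrite !mxE; field.
    by apply: contraTneq (pos j) => ->; rewrite mulr0 ltxx.
  rewrite !mxE !ler_norml in x0M *; move=> /andP[? ?]; move: x0M => /andP[? ?].
  by apply/andP; split; lra.
have cK : closed K.
  rewrite (_ : K =
    \bigcap_(v in [set v | v \in L]) [set y : 'rV[R]_m |
       \sum_i v ord0 i * y ord0 i = \sum_i v ord0 i * u ord0 i] `&`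
    \bigcap_(i in [set: 'I_m]) [set y : 'rV[R]_m | 0 <= x0 ord0 i * y ord0 i]).
    apply: closedI; [apply: closed_bigI => v _|apply: closed_bigI => i _].
      apply: (@preimage_closed _ _
        (fun y : 'rV[R]_m => \sum_i v ord0 i * y ord0 i)
        [set z | z = \sum_i v ord0 i * u ord0 i]); last exact: closed_eq.
      move=> y _; apply: (@continuous_big R 'I_m +%R 0 xpredT (@add_continuous R)).
      by move=> i _; exact: scaled_coord_continuous.
    apply: (@preimage_closed _ _ (fun y : 'rV[R]_m => x0 ord0 i * y ord0 i)
      [set z | 0 <= z]); last exact: closed_ge.
    by move=> y _; exact: scaled_coord_continuous.
  have sumB v y : \sum_i v ord0 i * (y - u) ord0 i =
      \sum_i v ord0 i * y ord0 i - \sum_i v ord0 i * u ord0 i.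
    by rewrite -sumrB; apply: eq_bigr => i _; rewrite !mxE mulrBr.
  apply/seteqP; split=> y [uy y0]; split.
  - by move=> v /uy /eqP; rewrite sumB subr_eq0 => /eqP.
  - by move=> i _; exact: y0.
  - by move=> v /uy /= yv; rewrite sumB yv subrr.
  - by move=> i; exact: y0.
have Kx0 : K x0 by split=> // i; exact: ltW.
(* On [K], this is [prod_i |y_i|] times a positive constant. *)
pose f y := \prod_i (x0 ord0 i * y ord0 i).
have cf : continuous f.
  apply: (@continuous_big R 'I_m *%R 1 xpredT (@mul_continuous R)) => i _.
  exact: scaled_coord_continuous.
have [||c] := @EVT_max_rV R m f K _ (bounded_closed_compact bK cK).
- by exists x0.
- exact: continuous_subspaceT.
rewrite inE => -[uc c0] cmax.
(* [f x0] is a product of nonzero squares, so the maximum is positive and no coordinate of [c]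
   vanishes. *)
have fc0 : 0 < f c.
  by apply: lt_le_trans (cmax x0 _); [exact: prodr_gt0|rewrite inE].
have cpos i : 0 < x0 ord0 i * c ord0 i.
  rewrite lt_neqAle c0 andbT eq_sym.
  apply: contraTneq fc0 => e.
  by rewrite /f (bigD1 i) //= e mul0r ltxx.
have cn0 i : c ord0 i != 0.
  by apply: contraTneq (cpos i) => ->; rewrite mulr0 ltxx.
have cc : complement c by [].
exists c; last by apply/connected_component_signP.
split=> //; apply: orthogonal_complementK => v ov.
(* Moving [c] along [v] stays in [u + L^perp], so [f] is maximal at [s = 0]; the coefficient ratios
   are [v_i / c_i]. *)
rewrite -[RHS](@prod_affine_max _ _ (fun i => x0 ord0 i * c ord0 i)
  (fun i => x0 ord0 i * v ord0 i)) //.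
  by apply: eq_bigr => i _; rewrite !mxE; field; rewrite x0n0 cn0.
move=> s sge0.
have := cmax (c + s *: v); rewrite inE /f.
have -> : \prod_i (x0 ord0 i * c ord0 i + s * (x0 ord0 i * v ord0 i)) =
          \prod_i (x0 ord0 i * (c + s *: v) ord0 i).
  by apply: eq_bigr => i _; rewrite !mxE; ring.
apply; split=> [|i].
  rewrite addrAC; apply: orthogonal_complementD => //.
  exact: orthogonal_complementZ.
by have := sge0 i; rewrite !mxE; congr (_ <= _); ring.
Qed.

(** Sending a critical point to its region is injective, with the bounded regions as image. *)
Lemma card_bounded_regions : (bounded_regions L u #= critical_points)%card.
Proof.
have -> : bounded_regions L u = connected_component complement @` critical_points.
  apply/seteqP; split=> [_ [[x0 cx0 <-] b]|_ [x Cx <-]].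
    have [x Cx x0x] := bounded_region_critical_point cx0 b.
    by exists x => //; rewrite (same_connected_component x0x).
  split; last exact: critical_point_region_bounded.
  by case: (Cx) => cx _; exists x.
apply: inj_card_eq => x y; rewrite !inE.
exact: critical_point_region_inj.
Qed.

Lemma critical_points_sign_inj x y : critical_points x -> critical_points y ->
  (forall i, (0 < x ord0 i) = (0 < y ord0 i)) -> x = y.
Proof.
move=> Cx Cy sxy; apply: critical_point_region_inj => //.
case: (Cx) (Cy) => [cx _] [cy _].
apply: same_connected_component; apply/connected_component_signP => //; split=> // i.
case: cx cy => [_ /(_ i) x0] [_ /(_ i) y0].
have := sxy i; case: ltrgt0P x0 => // xi _; case: ltrgt0P y0 => // yi _ _.
  by rewrite mulr_gt0.
by rewrite nmulr_rgt0.
Qed.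

End RealArrangement.

(** * Definable conditions hold or fail generically *)

Lemma genericW (F : comNzRingType) (n : nat) (P Q : 'rV[F]_n -> Prop) :
  (forall v, P v -> Q v) -> generic P -> generic Q.
Proof. by move=> PQ [p p0 pP]; exists p => // v /pP/PQ. Qed.

Lemma genericT (F : comNzRingType) (n : nat) (P : 'rV[F]_n -> Prop) :
  (forall v, P v) -> generic P.
Proof. by move=> PT; exists 1 => [|v _]; [exact: oner_neq0|exact: PT]. Qed.

Lemma generic_and (F : idomainType) (n : nat) (P Q : 'rV[F]_n -> Prop) :
  generic P -> generic Q -> generic (fun v => P v /\ Q v).
Proof.
move=> [p p0 pP] [q q0 qQ]; exists (p * q); first by rewrite mulf_neq0.
by move=> v; rewrite mevalM mulf_eq0 negb_or => /andP[/pP ? /qQ].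
Qed.

Section Definable.
Variable F : closedFieldType.
Implicit Types (P Q : (nat -> F) -> Prop) (g h : (nat -> F) -> F).

(** Environments are finite sequences padded with zeros; [rterm] excludes inverses, which leaves
    polynomial expressions. *)
Definition polynomial_function g : Prop :=
  exists2 t : GRing.term F, GRing.rterm t &
    forall e : seq F, GRing.eval e t = g (nth 0 e).

Definition definable P : Prop :=
  exists2 f : GRing.formula F, GRing.rformula f &
    forall e : seq F, GRing.holds e f <-> P (nth 0 e).

Lemma polynomial_function_var i : polynomial_function (fun v => v i).
Proof. by exists ('X_i)%T. Qed.

Lemma polynomial_function_const c : polynomial_function (fun=> c).
Proof. by exists (c%:T)%T. Qed.

Lemma polynomial_function_mul g h :
  polynomial_function g -> polynomial_function h ->
  polynomial_function (fun v => g v * h v).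
Proof.
move=> [t rt tE] [u ru uE]; exists (t * u)%T => /= [|e]; first by rewrite rt.
by rewrite tE uE.
Qed.

Lemma polynomial_function_sum (I : Type) (s : seq I) (g : I -> (nat -> F) -> F) :
  (forall i, polynomial_function (g i)) ->
  polynomial_function (fun v => \sum_(i <- s) g i v).
Proof.
move=> gP; elim: s => [|i s [t rt tE]].
  by exists (GRing.Const 0) => // e; rewrite big_nil.
have [u ru uE] := gP i; exists (u + t)%T => /= [|e]; first by rewrite ru.
by rewrite big_cons uE tE.
Qed.

Lemma definable_eq g h :
  polynomial_function g -> polynomial_function h ->
  definable (fun v => g v = h v).
Proof.
move=> [t rt tE] [u ru uE]; exists (t == u)%T => /= [|e]; first by rewrite rt.
by rewrite tE uE.
Qed.

Lemma definable_and P Q :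
  definable P -> definable Q -> definable (fun v => P v /\ Q v).
Proof.
move=> [f rf fE] [f' rf' fE']; exists (f /\ f')%T => /= [|e]; first by rewrite rf.
by rewrite fE fE'.
Qed.

Lemma definable_not P : definable P -> definable (fun v => ~ P v).
Proof. by move=> [f rf fE]; exists (~ f)%T => //= e; rewrite fE. Qed.

Lemma definable_forall (I : finType) (P : I -> (nat -> F) -> Prop) :
  (forall i, definable (P i)) -> definable (fun v => forall i, P i v).
Proof.
move=> dP.
have [f rf fE] : definable (fun v => forall i, i \in enum I -> P i v).
  elim: (enum I) => [|i s [f rf fE]]; first by exists (GRing.Bool true).
  have [f' rf' fE'] := dP i; exists (f' /\ f)%T => /= [|e]; first by rewrite rf'.
  rewrite fE fE'; split=> [[Pi Ps] j|Ps].
    by rewrite inE => /predU1P[->//|]; exact: Ps.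
  by split=> [|j js]; apply: Ps; rewrite inE ?eqxx ?js ?orbT.
exists f => // e; rewrite fE; split=> h i; last by move=> _; exact: h.
by apply: h; rewrite mem_enum.
Qed.

Lemma definable_exists_block P n N : definable P ->
  definable (fun v => exists w : nat -> F,
    P (fun j => if (n <= j < n + N)%N then w j else v j)).
Proof.
move=> dP; elim: N => [|N [f rf fE]].
  case: dP => f rf fE; exists f => // e; rewrite fE.
  have E w : (fun j => if (n <= j < n + 0)%N then w j else e`_j) = nth 0 e.
    by apply/funext => j; rewrite addn0; case: ltnP => // nj; rewrite leqNgt nj.
  by split=> [Pe|[w]]; [exists (fun=> 0)|]; rewrite E.
(* The new outer quantifier binds the variable [n + N], which the inner block leaves alone. *)
exists ('exists 'X_(n + N), f)%T => //= e; split=> [[x /fE[w]]|[w Pw]].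
  set z := (fun _ => _) => Pz.
  exists (fun j => if j == (n + N)%N then x else w j).
  rewrite (_ : (fun _ => _) = z) //; apply/funext => j.
  rewrite /z nth_set_nth /= addnS ltnS; case: (ltngtP j (n + N)%N) => // ->.
  by rewrite leq_addr.
exists (w (n + N)%N); apply/fE; exists w; move: Pw.
set z := (fun _ => _) => Pz; rewrite (_ : (fun _ => _) = z) //; apply/funext => j.
rewrite /z nth_set_nth /= addnS ltnS; case: (ltngtP j (n + N)%N) => // ->.
by rewrite leq_addr.
Qed.

(** The unknowns are stored in the variables from [n] on, in the order of [J]. As [Q] reads its
    parameters only below [n], overwriting those variables is harmless. *)
Lemma definable_exists (J : finType) n (Q : (nat -> F) -> (J -> F) -> Prop) :
  (forall v v' w, (forall i, (i < n)%N -> v i = v' i) -> Q v w -> Q v' w) ->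
  definable (fun z => Q z (fun a => z (n + enum_rank a)%N)) ->
  definable (fun v => exists w, Q v w).
Proof.
move=> Qn /(@definable_exists_block _ n #|J|)[f rf fE]; exists f => // e.
rewrite fE; split=> [[w]|[w Qw]].
  set z := (fun j => if _ then w j else _); set w' := (fun a => _) => Qz.
  exists w'; apply: Qn Qz => i lti; rewrite /z.
  by rewrite leqNgt lti.
exists (fun j => if insub (j - n)%N is Some r then w (enum_val (r : 'I_#|J|))
          else 0).
set z := (fun j => if _ then _ else e`_j).
have -> : (fun a => z (n + enum_rank a)%N) = w.
  apply/funext => a; rewrite /z leq_addr ltn_add2l ltn_ord /= addKn.
  by rewrite valK enum_rankK.
by apply: Qn Qw => i lti; rewrite /z leqNgt lti.
Qed.

Definition extend0 n (t : 'rV[F]_n) : seq F := [seq t ord0 i | i <- enum 'I_n].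

Lemma nth_extend0 n (t : 'rV[F]_n) (i : 'I_n) : (extend0 t)`_i = t ord0 i.
Proof. by rewrite (nth_map i) ?size_enum_ord ?nth_ord_enum. Qed.

(** Variables of index at least [n] read the padding value [0]. *)
Lemma eval_extend0 n (t : GRing.term F) : GRing.rterm t ->
  exists p : mpoly n F,
    forall v : 'rV[F]_n, GRing.eval (extend0 v) t = meval (v ord0) p.
Proof.
elim: t => //=.
- move=> i _; case: (ltnP i n) => [lti|nlei].
    exists (mpolyX F (mnm1 (Ordinal lti))) => v.
    by rewrite mevalXU -nth_extend0.
  by exists 0 => v; rewrite meval0 nth_default // size_map size_enum_ord.
- by move=> c _; exists (mpolyC n c) => v; rewrite mevalC.
- by move=> k _; exists k%:R => v; rewrite rmorph_nat.
- move=> t IHt u IHu /andP[/IHt[p pE] /IHu[q qE]].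
  by exists (p + q) => v; rewrite mevalD pE qE.
- by move=> t IHt /IHt[p pE]; exists (- p) => v; rewrite mevalN pE.
- by move=> t IHt k /IHt[p pE]; exists (p *+ k) => v; rewrite mevalMn pE.
- move=> t IHt u IHu /andP[/IHt[p pE] /IHu[q qE]].
  by exists (p * q) => v; rewrite mevalM pE qE.
- by move=> t IHt k /IHt[p pE]; exists (p ^+ k) => v; rewrite rmorphXn pE.
Qed.

(** A polynomial equation is an identity or fails wherever the difference of its sides is nonzero;
    connectives are settled where both truth values are known. *)
Lemma qf_eval_generic n (f : GRing.formula F) :
  GRing.qf_form f -> GRing.rformula f ->
  exists b, generic (fun v : 'rV[F]_n => GRing.qf_eval (extend0 v) f = b).
Proof.
have bin (op : bool -> bool -> bool) (f1 f2 : 'rV[F]_n -> bool) :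
    (exists b, generic (fun v => f1 v = b)) ->
    (exists b, generic (fun v => f2 v = b)) ->
    exists b, generic (fun v => op (f1 v) (f2 v) = b).
  move=> [b1 g1] [b2 g2]; exists (op b1 b2).
  by apply: genericW (generic_and g1 g2) => v [-> ->].
elim: f => //=.
- by move=> b _ _; exists b; exact: genericT.
- move=> t u _ /andP[/(eval_extend0 n)[p pE] /(eval_extend0 n)[q qE]].
  have [e|pq0] := eqVneq (p - q) 0.
    exists true; apply: genericT => v; rewrite pE qE.
    by rewrite -subr_eq0 -mevalB e meval0 eqxx.
  exists false, (p - q) => // v.
  by rewrite mevalB subr_eq0 pE qE => /negbTE.
- move=> f1 IH1 f2 IH2 /andP[q1 q2] /andP[r1 r2].
  by apply: (bin andb); [exact: IH1|exact: IH2].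
- move=> f1 IH1 f2 IH2 /andP[q1 q2] /andP[r1 r2].
  by apply: (bin orb); [exact: IH1|exact: IH2].
- move=> f1 IH1 f2 IH2 /andP[q1 q2] /andP[r1 r2].
  by apply: (bin implb); [exact: IH1|exact: IH2].
- move=> f IH qf rf; have [b fb] := IH qf rf.
  by exists (~~ b); apply: genericW fb => v ->.
Qed.

(** Quantifier elimination over [F] gives a quantifier-free formula, whose truth value is
    generically constant. *)
Lemma definable_generic n P : definable P ->
  generic (fun v : 'rV[F]_n => P (nth 0 (extend0 v))) \/
  generic (fun v : 'rV[F]_n => ~ P (nth 0 (extend0 v))).
Proof.
move=> [f rf fE].
have QE e := GRing.quantifier_elim_rformP (@ClosedFieldQE.wf_ex_elim F)
  (ClosedFieldQE.holds_ex_elim (@solve_monicpoly F)) e rf.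
have /andP[qf' rf'] := GRing.quantifier_elim_wf (@ClosedFieldQE.wf_ex_elim F) rf.
have [[] bP] := qf_eval_generic n qf' rf'; [left|right];
  apply: genericW bP => v vb.
- by apply/fE/QE.
- by move/fE/QE; rewrite vb.
Qed.

End Definable.

(** * Solutions of the likelihood equations *)

Definition has_points (T : Type) (S : set T) (k : nat) : Prop :=
  exists f : 'I_k -> T, injective f /\ forall l, S (f l).

Lemma card_eq_has_points (T : Type) (S : set T) (k : nat) :
  has_points S k -> ~ has_points S k.+1 -> (S #= `I_k)%card.
Proof.
move=> [f [finj fS]] nS.
have SE : S = f @` [set: 'I_k].
  apply/seteqP; split=> [x Sx|_ [l _ <-]]; last exact: fS.
  apply: contrapT => xf; apply: nS.
  (* A point missed by [f] goes to index [0], ahead of the values of [f], which makes [k + 1]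
     points. *)
  exists (fun i => if unlift ord0 i is Some j then f j else x).
  split=> [i j|i]; last by case: unliftP => [l|] _.
  case: unliftP => [a|] ->; case: unliftP => [b|] -> //.
  - by move=> /finj ->.
  - by move=> fa; case: xf; exists a.
  - by move=> fb; case: xf; exists b.
rewrite SE; apply: card_eq_trans (_ : [set: 'I_k] #= `I_k)%card.
  by apply: inj_card_eq => a b _ _; exact: finj.
rewrite card_eq_sym (_ : `I_k = val @` [set: 'I_k]).
  by apply: inj_card_eq => a b _ _; exact: val_inj.
apply/seteqP; split=> [i /= ik|_ [i _ <-]]; last exact: ltn_ord.
by exists (Ordinal ik).
Qed.

Lemma has_points_leq_card (T : Type) (S : set T) (k : nat) (J : finType)
    (h : T -> J) :
  (forall x y, S x -> S y -> h x = h y -> x = y) -> has_points S k -> (k <= #|J|)%N.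
Proof.
move=> hinj [f [finj fS]]; rewrite -[k]card_ord.
by apply: (@leq_card _ _ (h \o f)) => a b /hinj e; apply: finj; exact: e.
Qed.

(** The least [N] for which [N] points are not generic is positive, as [0] points always exist. Its
    predecessor [k] is the count, since by the dichotomy [k + 1] points are generically absent. *)
Lemma generic_card (F : idomainType) (n : nat) (T : Type)
    (S : 'rV[F]_n -> set T) :
  (forall k, generic (fun t => has_points (S t) k) \/
             generic (fun t => ~ has_points (S t) k)) ->
  (exists N, ~ generic (fun t => has_points (S t) N)) ->
  exists k, generic (fun t => (S t #= `I_k)%card).
Proof.
move=> dich exN.
have {}exN : exists N, ~~ `[< generic (fun t => has_points (S t) N) >].
  by case: exN => N nN; exists N; apply/asboolPn.
case: (ex_minnP exN) => -[|k] /asboolPn nk mink.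
  case: nk; apply: genericT => t.
  have f : 'I_0 -> T by case.
  by exists f; split=> -[].
have gk : generic (fun t => has_points (S t) k).
  by apply/asboolP; apply: contraT => /mink; rewrite ltnn.
exists k; have [//|gk1] := dich k.+1.
by apply: genericW (generic_and gk gk1) => t [? ?]; exact: card_eq_has_points.
Qed.

(** * Solution counts as first-order conditions on the data *)

Section MatrixSystem.
Variables (F : closedFieldType) (d m e : nat) (A : 'M[F]_(d, m)) (K : 'M[F]_(m, e)).

Definition reciprocal_solutions (t : 'rV[F]_d) : set 'rV[F]_m :=
  [set x : 'rV[F]_m | [/\ forall i, x ord0 i != 0, x *m A^T = t
             & map_mx GRing.inv x *m K = 0]].

Let block k := ('I_k * 'I_m * bool)%type.

(* w (l, i, false) and w (l, i, true) are the i-th coordinate of the l-th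
   solution and its inverse. *)
Let system k (v : nat -> F) (w : block k -> F) : Prop :=
  [/\ forall (l : 'I_k) i, w (l, i, false) * w (l, i, true) = 1,
      forall (l : 'I_k) (j : 'I_d), \sum_i w (l, i, false) * A j i = v j,
      forall (l : 'I_k) (j : 'I_e), \sum_i w (l, i, true) * K i j = 0
    & forall l l' : 'I_k, l != l' -> ~ forall i, w (l, i, false) = w (l', i, false)].

(** Making each inverse an unknown of its own, with product [1], keeps the system polynomial and
    forces nonzero coordinates. *)
Lemma has_points_systemP k (t : 'rV[F]_d) :
  has_points (reciprocal_solutions t) k <->
  exists w, @system k (nth 0 (extend0 t)) w.
Proof.
split=> [[f [finj fS]]|[w [wV wA wK winj]]].
  exists (fun a => if a.2 then (f a.1.1 ord0 a.1.2)^-1 else f a.1.1 ord0 a.1.2).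
  split=> /= [l i|l j|l j|l l' ll' e'].
  - by case: (fS l) => f0 _ _; rewrite divff.
  - case: (fS l) => _ <- _; rewrite nth_extend0 mxE.
    by apply: eq_bigr => i _; rewrite mxE.
  - case: (fS l) => _ _ /rowP/(_ j); rewrite !mxE => /(eq_trans _); apply.
    by apply: eq_bigr => i _; rewrite mxE.
  - case/eqP: ll'; apply: finj; apply/rowP => i; exact: e'.
exists (fun l => \row_i w (l, i, false)); split=> [l l' ll'|l].
  apply/eqP/contraT => /winj; case=> i.
  by move/rowP/(_ i): ll'; rewrite !mxE.
have w0 i : w (l, i, false) != 0.
  by apply: contra_eq_neq (wV l i) => ->; rewrite mul0r eq_sym oner_neq0.
split=> [i||].
- by rewrite mxE.
- apply/rowP => j; rewrite mxE -nth_extend0 -(wA l j).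
  by apply: eq_bigr => i _; rewrite !mxE.
- apply/rowP => j; rewrite !mxE -[RHS](wK l j); apply: eq_bigr => i _.
  by rewrite !mxE -[_^-1]mulr1 -(wV l i) mulKf.
Qed.

Lemma definable_system k : definable (fun v => exists w, @system k v w).
Proof.
(* The data [t] fill the first [d] variables; the unknowns follow. *)
apply: (@definable_exists _ _ d) => [v v' w vv' [wV wA wK winj]|].
  by split=> // l j; rewrite wA vv'.
have var i := @polynomial_function_var F i.
have cst c := @polynomial_function_const F c.
pose P1 (a : 'I_k * 'I_m) (z : nat -> F) :=
  z (d + enum_rank ((a, false) : block k))%N *
  z (d + enum_rank ((a, true) : block k))%N = 1.
pose P2 (a : 'I_k * 'I_d) (z : nat -> F) :=
  \sum_i z (d + enum_rank ((a.1, i, false) : block k))%N * A a.2 i = z a.2.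
pose P3 (a : 'I_k * 'I_e) (z : nat -> F) :=
  \sum_i z (d + enum_rank ((a.1, i, true) : block k))%N * K i a.2 = 0.
pose P4 (a : 'I_k * 'I_k) (z : nat -> F) := ~ (a.1 != a.2 /\ forall i : 'I_m,
  z (d + enum_rank ((a.1, i, false) : block k))%N =
  z (d + enum_rank ((a.2, i, false) : block k))%N).
have [f rf fE] : definable (fun z => ((forall a, P1 a z) /\ (forall a, P2 a z)) /\
    ((forall a, P3 a z) /\ (forall a, P4 a z))).
  apply: definable_and; apply: definable_and; apply: definable_forall => a.
  - by apply: definable_eq => //; exact: polynomial_function_mul.
  - apply: definable_eq => //; apply: polynomial_function_sum => i.
    exact: polynomial_function_mul.
  - apply: definable_eq => //; apply: polynomial_function_sum => i.
    exact: polynomial_function_mul.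
  - apply: definable_not; apply: definable_and.
      by exists (GRing.Bool (a.1 != a.2)).
    by apply: definable_forall => i; exact: definable_eq.
exists f => // z; rewrite fE; split=> [[[h1 h2] [h3 h4]]|[h1 h2 h3 h4]].
  split=> [l i|l j|l j|l l' ll' e'].
  - exact: (h1 (l, i)).
  - exact: (h2 (l, j)).
  - exact: (h3 (l, j)).
  - by apply: (h4 (l, l')).
split; split=> -[l j].
- exact: h1.
- exact: h2.
- exact: h3.
- by case=> /= lj; exact: h4.
Qed.

Lemma reciprocal_solutions_generic k :
  generic (fun t => has_points (reciprocal_solutions t) k) \/
  generic (fun t => ~ has_points (reciprocal_solutions t) k).
Proof.
have [g|g] := definable_generic d (definable_system k); [left|right];
  by apply: genericW g => t; rewrite has_points_systemP.
Qed.

End MatrixSystem.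

(** * Complex solutions and their real and imaginary parts *)

Section ComplexSolutions.
Variable R : realType.
Local Notation rc := (real_complex R).

Lemma map_Re_mulmx (p q r : nat) (B : 'M[R[i]]_(p, q)) (D : 'M[R]_(q, r)) :
  map_mx (@complex.Re R) (B *m map_mx rc D) = map_mx (@complex.Re R) B *m D.
Proof.
apply/matrixP => i j; rewrite !mxE.
rewrite (raddf_sum (@complex.Re R)).
apply: eq_bigr => k _; rewrite !mxE; case: (B i k) => a b /=.
by rewrite mulr0 subr0.
Qed.

Lemma map_Im_mulmx (p q r : nat) (B : 'M[R[i]]_(p, q)) (D : 'M[R]_(q, r)) :
  map_mx (@complex.Im R) (B *m map_mx rc D) = map_mx (@complex.Im R) B *m D.
Proof.
apply/matrixP => i j; rewrite !mxE.
rewrite (raddf_sum (@complex.Im R)).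
apply: eq_bigr => k _; rewrite !mxE; case: (B i k) => a b /=.
by rewrite mulr0 add0r.
Qed.

Lemma mx_complex_eq0 (p q : nat) (B : 'M[R[i]]_(p, q)) :
  map_mx (@complex.Re R) B = 0 -> map_mx (@complex.Im R) B = 0 -> B = 0.
Proof.
move=> /matrixP Re0 /matrixP Im0; apply/matrixP => i j.
by have := Re0 i j; have := Im0 i j; rewrite !mxE; case: (B i j) => a b /= -> ->.
Qed.

Variables (d m : nat) (L : {vspace 'rV[R]_m}) (A : 'M[R]_(d, m)).
Hypothesis rowA : is_row_space A L.

(** The equations [cokermx A] of [L] are real, so over [R[i]] they split into real and imaginary
    parts. *)
Lemma likelihood_solutionsE (t : 'rV[R[i]]_d) :
  likelihood_solutions A L t =
  reciprocal_solutions (map_mx rc A) (map_mx rc (cokermx A)) t.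
Proof.
apply/seteqP; split=> x [x0 xA xL]; split=> //.
  case: xL; rewrite !rowA !submxE => /eqP ReL /eqP ImL.
  by apply: mx_complex_eq0; rewrite ?map_Re_mulmx ?map_Im_mulmx.
split; rewrite rowA submxE; apply/eqP.
  by rewrite -map_Re_mulmx xL; apply/matrixP => i j; rewrite !mxE.
by rewrite -map_Im_mulmx xL; apply/matrixP => i j; rewrite !mxE.
Qed.

(* For real data, 0 = <Im x, Im (1/x)> = - sum_i (Im x_i)^2 / |x_i|^2. *)
Lemma likelihood_solutions_real (u : 'rV[R]_m) :
  likelihood_solutions A L (map_mx rc (u *m A^T)) = map_mx rc @` critical_points L u.
Proof.
apply/seteqP; split=> [z [z0 zA [zReL zL]]|_ [x [[ux x0] Lx] <-]].
  have zRe : map_mx (@complex.Re R) z *m A^T = u *m A^T.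
    have := congr1 (map_mx (@complex.Re R)) zA; rewrite map_trmx map_Re_mulmx => ->.
    by apply/matrixP => i j; rewrite !mxE.
  have zIm : map_mx (@complex.Im R) z *m A^T = 0.
    have := congr1 (map_mx (@complex.Im R)) zA; rewrite map_trmx map_Im_mulmx => ->.
    by apply/matrixP => i j; rewrite !mxE.
  have Im0 i : complex.Im (z ord0 i) = 0.
    have := (orthogonal_complementP rowA _).2 zIm _ zL => /eqP.
    rewrite -oppr_eq0 -sumrN psumr_eq0 => [|j _].
      move=> /allP h; have := h i (mem_index_enum i).
      rewrite /= !mxE; have := z0 i; case: (z ord0 i) => a b /=.
      have [-> //|b0] := eqVneq b 0.
      rewrite mulNr opprK !mulf_eq0 (negbTE b0) invr_eq0 /= orbF.
      rewrite paddr_eq0 ?sqr_ge0 // !expf_eq0 /= (negbTE b0) andbF.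
      by [].
    rewrite !mxE; case: (z ord0 j) => a b /=.
    by rewrite mulNr opprK mulrAC divr_ge0 ?addr_ge0 ?sqr_ge0 // -expr2 sqr_ge0.
  have zE : z = map_mx rc (map_mx (@complex.Re R) z).
    apply/rowP => i; rewrite !mxE; have := Im0 i.
    by case: (z ord0 i) => a b /= ->.
  exists (map_mx (@complex.Re R) z) => //; split; first split.
  - by apply/(orthogonal_complementP rowA); rewrite mulmxBl zRe subrr.
  - by move=> i; have := z0 i; rewrite {1}zE mxE fmorph_eq0.
  - move: zReL; rewrite zE; congr (_ \in L); apply/rowP => i.
    by rewrite !mxE -fmorphV.
split.
- by move=> i; rewrite mxE fmorph_eq0.
- rewrite map_trmx -map_mxM; congr map_mx.
  by apply/eqP; rewrite -subr_eq0 -mulmxBl; apply/eqP/(orthogonal_complementP rowA).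
- split; last first.
    rewrite (_ : map_mx _ _ = 0) ?rpred0 //; apply/rowP => i.
    by rewrite !mxE -fmorphV.
  by move: Lx; congr (_ \in L); apply/rowP => i; rewrite !mxE -fmorphV.
Qed.

End ComplexSolutions.

(** The [\rank A] rows of a row basis span [L], so [d] is at most the rank. *)
Lemma row_free_row_space (R : realType) (d m : nat) (L : {vspace 'rV[R]_m})
    (A : 'M[R]_(d, m)) :
  \dim L = d -> is_row_space A L -> row_free A.
Proof.
move=> dimL rowA; rewrite /row_free eqn_leq rank_leq_row -{1}dimL.
pose X := [seq row i (row_base A) | i <- enum 'I_(\rank A)].
have sX : (size X <= \rank A)%N by rewrite size_map size_enum_ord.
apply: leq_trans (leq_trans (dim_span X) sX); apply: dimvS; apply/subvP => v.
rewrite rowA -(eq_row_base A) => /submxP[c ->]; rewrite mulmx_sum_row.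
apply: memv_suml => i _; apply: memvZ; apply: memv_span.
by apply/mapP; exists i; rewrite ?mem_enum.
Qed.

(** * From generic complex data to generic real points *)

Section RealParts.
Variable R : realType.
Local Notation rc := (real_complex R).

(* The real or the imaginary part of the polynomial exhibiting the genericity of
   P, composed with u |-> u A^T, is a nonzero polynomial over R. *)
Lemma generic_real_image (d m : nat) (A : 'M[R]_(d, m)) (P : 'rV[R[i]]_d -> Prop) :
  row_free A -> generic P ->
  generic (fun u : 'rV[R]_m => P (map_mx rc (u *m A^T))).
Proof.
move=> /row_freeP[B AB] [p p0 pP].
(* Apply [h] to the coefficients of [p] and substitute the linear form [sum_i A_ji u_i] for its
   [j]-th variable. *)
pose part (h : R[i] -> R) : mpoly m R := \sum_(k <- msupp p)
  (h (mcoeff k p)) *: \prod_(j < d) (\sum_i A j i *: mpolyX R (mnm1 i)) ^+ (k j).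
have partE (h : {additive R[i] -> R}) (u : 'rV[R]_m) :
    (forall x a, h (x * rc a) = h x * a) ->
    meval (u ord0) (part h) = h (meval (map_mx rc (u *m A^T) ord0) p).
  move=> hM; rewrite [in RHS]mevalE (raddf_sum h).
  rewrite /part (raddf_sum (meval (u ord0))) /=.
  apply: eq_bigr => k _.
  rewrite mevalZ rmorph_prod.
  rewrite (_ : \prod_(j < d) map_mx rc (u *m A^T) ord0 j ^+ k j =
    rc (\prod_(j < d) ((u *m A^T) ord0 j) ^+ k j)).
    rewrite hM; congr (_ * _); apply: eq_bigr => j _.
    rewrite rmorphXn (raddf_sum (meval (u ord0))) /= mxE; congr (_ ^+ _).
    by apply: eq_bigr => i _; rewrite mevalZ mevalXU mxE mulrC.
  by rewrite rmorph_prod; apply: eq_bigr => j _; rewrite mxE rmorphXn.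
have ReM (x : R[i]) a : complex.Re (x * rc a) = complex.Re x * a.
  by case: x => b c /=; rewrite mulr0 subr0.
have ImM (x : R[i]) a : complex.Im (x * rc a) = complex.Im x * a.
  by case: x => b c /=; rewrite mulr0 add0r.
(* Positive elements of [R[i]] are real, so [p] is nonzero at a real vector. *)
have [w w0 pw] := generic_positive_point p0.
pose t : 'rV[R]_d := \row_i complex.Re (w i).
have wE : meval (map_mx rc t ord0) p = meval w p.
  apply: meval_eq => i; rewrite !mxE.
  by have := ger0_Im (ltW (w0 i)); case: (w i) => a b /= ->.
(* [B] is a right inverse of [A], so the real vector [t *m B^T] has data [t]. *)
have tE : t *m B^T *m A^T = t by rewrite -mulmxA -trmx_mul AB trmx1 mulmx1.
have neq0 (h : {additive R[i] -> R}) : (forall x a, h (x * rc a) = h x * a) ->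
    h (meval w p) != 0 ->
    generic (fun u : 'rV[R]_m => P (map_mx rc (u *m A^T))).
  move=> hM hw; exists (part h) => [|u].
    by apply: contraNneq hw => e; rewrite -wE -{1}tE -partE // e meval0.
  by rewrite partE // => hu; apply: pP; apply: contraNneq hu => ->; rewrite raddf0.
have [Re0|] := eqVneq (complex.Re (meval w p)) 0; last exact: neq0 ReM.
apply: (neq0 (@complex.Im R) ImM).
by apply: contraNneq pw => Im0; apply/eqP/eqP; rewrite eq_complex Re0 Im0 !eqxx.
Qed.

End RealParts.

(** * Existence of the ML degree and comparison with bounded regions *)

Section ConcentrationModel.
Variables (R : realType) (d m : nat) (L : {vspace 'rV[R]_m}) (A : 'M[R]_(d, m)).
Hypothesis rowA : is_row_space A L.

Lemma card_likelihood_solutions_real (u : 'rV[R]_m) :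
  (bounded_regions L u #=
     likelihood_solutions A L (map_mx (real_complex R) (u *m A^T)))%card.
Proof.
apply: card_eq_trans (card_bounded_regions rowA u) _.
rewrite (likelihood_solutions_real rowA) card_eq_sym; apply: inj_card_eq => x y _ _.
exact: map_mx_inj.
Qed.

(** At real data the solutions are real critical points, which their sign patterns tell apart. *)
Lemma real_likelihood_solutions_leq k (u : 'rV[R]_m) :
  has_points (likelihood_solutions A L (map_mx (real_complex R) (u *m A^T))) k ->
  (k <= #|{ffun 'I_m -> bool}|)%N.
Proof.
apply: (@has_points_leq_card _ _ _ _
  (fun z : 'rV[R[i]]_m => [ffun i : 'I_m => 0 < z ord0 i])).
rewrite (likelihood_solutions_real rowA) => _ _ [x Cx <-] [y Cy <-] /ffunP sxy.
congr map_mx; apply: (critical_points_sign_inj rowA Cx Cy) => i.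
by have := sxy i; rewrite !ffunE !mxE !ltcR.
Qed.

Lemma ML_degree_exists : row_free A -> exists n, is_ML_degree A L n.
Proof.
move=> freeA; apply: generic_card => [k|].
  rewrite (_ : likelihood_solutions A L = reciprocal_solutions
    (map_mx (real_complex R) A) (map_mx (real_complex R) (cokermx A))).
    exact: reciprocal_solutions_generic.
  by apply/funext => t; exact: likelihood_solutionsE.
(* Were [2^m + 1] solutions generic, some real [u] would have more solutions than there are sign
   patterns. *)
exists (#|{ffun 'I_m -> bool}|).+1 => /(generic_real_image freeA)[p p0 pP].
have [u _ pu] := generic_positive_point p0.
have /pP/real_likelihood_solutions_leq : meval ((\row_i u i) ord0) p != 0.
  by rewrite (_ : meval _ p = meval u p) //; apply: meval_eq => i; rewrite mxE.
by rewrite ltnn.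
Qed.

End ConcentrationModel.

Theorem corollary3p3 (R : realType) (d m : nat)
    (L : {vspace 'rV[R]_m}) (A : 'M[R]_(d, m))
    (dimL : \dim L = d)
    (posL : exists2 v : 'rV[R]_m, v \in L & positive_vector v)
    (rowA : is_row_space A L) :
  exists n : nat, is_ML_degree A L n /\ is_beta L n.
Proof.
have freeA := row_free_row_space dimL rowA.
have [n degA] := ML_degree_exists rowA freeA; exists n; split=> //.
(* The generic solution count pulls back to generic [u], where it equals the number of bounded
   regions. *)
apply: genericW (generic_real_image freeA degA) => u cu _.
exact: card_eq_trans (card_likelihood_solutions_real rowA u) cu.
Qed.
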